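(* For every natural number $n$, there is a digraph $D$ with two Grundy functions $f$ and $g$ such that $\max\{f(x): x\in V(D)\}-\max\{g(x): x\in V(D)\}=n$.
   Context: For a vertex $x$ of a digraph $D$, $\Gamma^+(x)$ denotes the set of out-neighbours of $x$. A function $g:V(D)\to\{0,1,2,\dots\}$ is a Grundy function of $D$ if for every vertex $x$, $g(x)$ is the smallest non-negative integer not belonging to $\{g(y): y\in\Gamma^+(x)\}$. *)

(* Defs.v *)
From mathcomp Require Import all_boot all_order all_algebra.

Set Implicit Arguments.
Unset Strict Implicit.
Unset Printing Implicit Defensive.

(* Finite and with at least one vertex, so that maxima over the vertex set
   make sense.  Opposite arcs are allowed; loops are not excluded here, but a
   digraph with a loop has no Grundy function. *)
Record digraph := Digraph {
  vertex : finType;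
  arc : rel vertex;
  vertex_nonempty : 0 < #|vertex|
}.

Definition out_neighbours (D : digraph) (x : vertex D) : {set vertex D} :=
  [set y | arc x y].

Definition smallest_not_in (s : seq nat) (k : nat) : Prop :=
  k \notin s /\ forall m : nat, m \notin s -> k <= m.

Definition grundy_function (D : digraph) (g : vertex D -> nat) : Prop :=
  forall x : vertex D,
    smallest_not_in [seq g y | y in out_neighbours x] (g x).

(* Main.v *)
Require Import Defs.
From mathcomp Require Import all_boot all_order all_algebra.

(** In the symmetric digraph obtained from the complete bipartite graph
    [K_(n+2, n+2)] by deleting a perfect matching, the side of a vertex is a
    Grundy function with maximum [1], while the index of its matching edge is a
    Grundy function with maximum [n + 1]. *)

Definition crown_arc (m : nat) : rel ('I_m * bool) :=
  fun x y => (x.1 != y.1) && (x.2 != y.2).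

Lemma card_crown_gt0 (m : nat) : 0 < #|{: 'I_m.+2 * bool}|.
Proof. by rewrite card_prod card_ord card_bool. Qed.

(** The shift by two gives at least two matching edges, so every vertex has an out-neighbour even
    for [m = 0]. *)
Definition crown (m : nat) : digraph :=
  Digraph (@crown_arc m.+2) (card_crown_gt0 m).

(** Minimality follows by contraposition: a value below [g x] is attained at an out-neighbour, hence
    is not missing. *)
Lemma grundy_functionP (D : digraph) (g : vertex D -> nat) :
  (forall x y, Defs.arc x y -> g y <> g x) ->
  (forall x k, k < g x -> exists2 y, Defs.arc x y & g y = k) ->
  grundy_function g.
Proof.
move=> g_proper g_below x; split=> [|k].
  apply/negP=> /imageP[y]; rewrite inE => xy /esym; exact: g_proper xy.
apply: contraR; rewrite -ltnNge => /g_below[y xy <-].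
by apply/imageP; exists y; rewrite ?inE.
Qed.

Lemma crown_index_grundy (m : nat) :
  @grundy_function (crown m) (fun x => x.1 : nat).
Proof.
apply: grundy_functionP => [x y /andP[/eqP neq_xy _] eq_yx | x k lt_kx].
  by apply/neq_xy/val_inj.
have lt_km : k < m.+2 := ltn_trans lt_kx (ltn_ord x.1).
(* Only the matching is deleted, so [x] has an arc to every other index on the opposite side. *)
exists (Ordinal lt_km, ~~ x.2) => //=.
by rewrite /crown_arc -val_eqE /= (gtn_eqF lt_kx); case: (x.2).
Qed.

Lemma crown_side_grundy (m : nat) :
  @grundy_function (crown m) (fun x => x.2 : nat).
Proof.
apply: grundy_functionP => [[i b] [j c] /andP[_ /=] | [i [|]] [|k] //= _].
  by case: b c => [] [].
(* What remains is the value 0 below side [true]: any index other than [i] serves, and [ord0] and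
   [ord_max] are distinct. *)
exists (if i == ord0 then ord_max else ord0, false) => //=.
by rewrite /crown_arc andbT /=; case: (eqVneq i ord0) => [->|].
Qed.

Lemma max_crown_index (m : nat) :
  \max_(x : vertex (crown m)) (x.1 : nat) = m.+1.
Proof.
apply/eqP; rewrite eqn_leq; apply/andP; split.
  by apply/bigmax_leqP => x _; rewrite -ltnS ltn_ord.
exact: (@leq_bigmax _ (fun x : vertex (crown m) => x.1 : nat) (ord_max, true)).
Qed.

Lemma max_crown_side (m : nat) :
  \max_(x : vertex (crown m)) (x.2 : nat) = 1.
Proof.
apply/eqP; rewrite eqn_leq; apply/andP; split.
  by apply/bigmax_leqP => x _; rewrite leq_b1.
exact: (@leq_bigmax _ (fun x : vertex (crown m) => x.2 : nat) (ord0, true)).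
Qed.

Theorem theorem8 (n : nat) :
  exists (D : digraph) (f g : vertex D -> nat),
    grundy_function f /\ grundy_function g /\
    ((\max_(x : vertex D) f x)%N%:Z - (\max_(x : vertex D) g x)%N%:Z = n%:Z)%R.
Proof.
exists (crown n), (fun x : vertex (crown n) => x.1 : nat),
  (fun x : vertex (crown n) => x.2 : nat).
split; first exact: crown_index_grundy.
split; first exact: crown_side_grundy.
by rewrite max_crown_index max_crown_side -addn1 PoszD GRing.addrK.
Qed.
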